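(* Let $d$ be a positive integer and let $$x(d)= \frac{ ((2d-1)!)^d }{\binom{2d-1}{d}^2((d-1)!)^d N(d)}.$$ Then for every positive integer $t$: (1) if $t<x(d)$, then $\chi_c^\star(K_{d,t})<2d$; (2) if $t \ge x(d)\cdot d \log\left((2d-1)!\right)$, then $\chi_c^\star(K_{d,t})=2d$.
   Context: $K_{d,t}$ is the complete bipartite graph with parts of sizes $d$ and $t$. $N(d)$ denotes the number of Latin squares of order $d$ (i.e. $d\times d$ arrays with entries from $\{1,\dots,d\}$ in which every row and every column has distinct entries), and $\log$ is the natural logarithm. For a graph $G$ and a positive integer $k$, a $k$-fold correspondence-cover of $G$ is a graph $H$ whose vertex set is partitioned into sets $L(v)=\{1_v,\dots,k_v\}$, $v\in V(G)$, such that each $L(v)$ is independent in $H$, there are no edges of $H$ between $L(u)$ and $L(v)$ when $uv\notin E(G)$, and for every edge $uv\in E(G)$ the edges of $H$ between $L(u)$ and $L(v)$ form a matching. A correspondence-colouring of $H$ is an independent set of $H$ containing exactly one vertex of each $L(v)$. A correspondence-packing of $H$ is a collection of $k$ pairwise disjoint correspondence-colourings of $H$. The correspondence packing number $\chi_c^\star(G)$ is the least $k$ such that every $k$-fold correspondence-cover of $G$ admits a correspondence-packing. *)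

(* Defs.v *)
(* Graphs are relations on a [finType]; [ln] is the natural logarithm over an
   arbitrary [realType]. *)
From HB Require Import structures.
From mathcomp Require Import all_boot all_order all_algebra.
From mathcomp Require Import reals exp.

Set Implicit Arguments.
Unset Strict Implicit.
Unset Printing Implicit Defensive.

Import Order.TTheory GRing.Theory Num.Theory.

Definition simple_graph (W : finType) (e : rel W) : Prop :=
  symmetric e /\ irreflexive e.

Definition complete_bipartite (d t : nat) : rel ('I_d + 'I_t) :=
  fun x y => match x, y with
             | inl _, inr _ | inr _, inl _ => true
             | _, _ => false
             end.

Lemma complete_bipartite_simple (d t : nat) :
  simple_graph (@complete_bipartite d t).
Proof. by split=> [[?|?] [?|?]|[?|?]]. Qed.

(* The vertex (v, i) of a k-fold cover is the colour i_v. *)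
Definition Lset (V : finType) (k : nat) (v : V) : {set V * 'I_k} :=
  [set x | x.1 == v].

Definition independent (W : finType) (e : rel W) (S : {set W}) : Prop :=
  {in S &, forall x y, ~~ e x y}.

(* Two distinct edges of [H] between [A] and [B] share no end.  An edge is
   recorded as the ordered pair of its end in [A] and its end in [B], so [A]
   and [B] are meant to be disjoint. *)
Definition matching_between (W : finType) (H : rel W) (A B : {set W}) : Prop :=
  forall a b a' b', a \in A -> b \in B -> a' \in A -> b' \in B ->
    H a b -> H a' b' -> (a, b) <> (a', b') -> a <> a' /\ b <> b'.

Definition correspondence_cover (V : finType) (G : rel V) (k : nat)
    (H : rel (V * 'I_k)) : Prop :=
  [/\ simple_graph H,
      forall v, independent H (Lset k v),
      forall u v, ~~ G u v ->
        forall x y, x \in Lset k u -> y \in Lset k v -> ~~ H x y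
    & forall u v, G u v -> matching_between H (Lset k u) (Lset k v)].

Definition correspondence_colouring (V : finType) (k : nat)
    (H : rel (V * 'I_k)) (S : {set V * 'I_k}) : Prop :=
  independent H S /\ forall v, #|S :&: Lset k v| = 1.

Definition correspondence_packing (V : finType) (k : nat)
    (H : rel (V * 'I_k)) (P : 'I_k -> {set V * 'I_k}) : Prop :=
  (forall i, correspondence_colouring H (P i)) /\
  (forall i j, i != j -> [disjoint P i & P j]).

Definition packable (V : finType) (G : rel V) (k : nat) : Prop :=
  forall H : rel (V * 'I_k), correspondence_cover G H ->
    exists P, correspondence_packing H P.

(* The graph of the partial function sending [G] to its correspondence packing
   number: [k] is the least positive integer with [packable G k].  Positivity
   matters, since [packable G 0] holds vacuously. *)
Definition correspondence_packing_number (V : finType) (G : rel V)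
    (k : nat) : Prop :=
  [/\ 0 < k, packable G k & forall j, 0 < j -> packable G j -> k <= j].

Lemma correspondence_packing_number_uniq (V : finType) (G : rel V) k l :
  correspondence_packing_number G k -> correspondence_packing_number G l ->
  k = l.
Proof.
move=> [k0 pk mk] [l0 pl ml].
by apply/eqP; rewrite eqn_leq mk // ml.
Qed.

Definition latin_square (d : nat) (M : 'M['I_d]_d) : bool :=
  [forall i, injectiveb (fun j => M i j)] &&
  [forall j, injectiveb (fun i => M i j)].

Definition num_latin_squares (d : nat) : nat :=
  #|[set M : 'M['I_d]_d | latin_square M]|.

Definition xthreshold (R : realType) (d : nat) : R :=
  ((((2 * d - 1)`!) ^ d)%:R /
   ('C(2 * d - 1, d) ^ 2 * ((d - 1)`!) ^ d * num_latin_squares d)%:R)%R.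

(* Main.v *)
(* Let k be the number of colours.  Extending the matchings of a cover of
   K_{d,t} to perfect ones, a vertex b of the part of size t carries
   permutations q_{b,1}, ..., q_{b,d} of the colours, and a packing on the part
   of size d is a family p_1, ..., p_d of permutations.  It extends to b iff some
   permutation disagrees everywhere with all the p_i q_{b,i}.  By Hall's
   theorem this fails iff these products cover a rectangle S x T with
   |S| + |T| > k; since |S|, |T| <= d, it never happens for k = 2d, and for
   k = 2d - 1 the rectangle is a unique d x d one on which the products form a
   Latin square, so that exactly a fraction 1 / x(d) of the families is bad.
   (1) is then the union bound over b for a random p, and (2) the union bound
   over all p for a random cover. *)
Require Import Defs.
From HB Require Import structures.
From mathcomp Require Import all_boot all_order all_fingroup all_algebra.
From mathcomp Require Import zify.
From mathcomp Require Import boolp reals sequences exp.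

Set Implicit Arguments.
Unset Strict Implicit.
Unset Printing Implicit Defensive.

Import Order.TTheory GRing.Theory Num.Theory.

(** * Hall's theorem and the extension of partial matchings *)

(** Induction on a bound for the size of [D], with matchings as functions on all of [T] constrained
    only on [D]: either a proper nonempty subset of [D] is tight and [D] splits along it, or each
    such subset has a spare neighbour and one pair can be matched freely. *)
Lemma hall (T : finType) (r : rel T) :
  (forall S : {set T}, #|S| <= #|[set y | [exists x in S, r x y]]|) ->
  exists s : {perm T}, forall x, r x (s x).
Proof.
move=> hallr.
suff main n (D : {set T}) (q : rel T) : #|D| <= n ->
    (forall S : {set T}, S \subset D ->
       #|S| <= #|[set y | [exists x in S, q x y]]|) ->
    exists2 f : T -> T, {in D &, injective f} & {in D, forall x, q x (f x)}.
  have [f injf rf] := main _ [set: T] r (leqnn _) (fun S _ => hallr S).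
  have injf' : injective f by move=> x y; apply: injf; rewrite inE.
  by exists (perm injf') => x; rewrite permE rf ?inE.
elim: n D q => [|n IHn] D q leDn hallq.
  have D0 : D = set0 by apply/eqP; rewrite -cards_eq0 -leqn0.
  by exists id => x; rewrite D0 inE.
have [->|[x0 Dx0]] := set_0Vmem D; first by exists id => x; rewrite inE.
pose N (S : {set T}) := [set y | [exists x in S, q x y]].
have [/existsP[S /and4P[sSD S0 nSD leNS]]|/existsPn noS] :=
  boolP [exists S : {set T}, [&& S \subset D, S != set0, S != D & #|N S| <= #|S|]].
  have ltSD : #|S| < #|D| by rewrite proper_card // properEneq nSD.
  have [|S' sS'|f injf qf] := IHn S q.
  - by rewrite -ltnS (leq_trans ltSD).
  - exact: hallq (subset_trans sS' sSD).
  (* Off the tight [S] only partners outside [N S] are allowed; the condition for [S'] follows from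
     that for [S :|: S'], as [S] has at most #|S| neighbours. *)
  have [||g injg qg] := IHn (D :\: S) (fun x y => q x y && (y \notin N S)).
  - rewrite -ltnS (leq_trans _ leDn) // cardsD (setIidPr sSD).
    by rewrite ltn_subrL card_gt0 S0 (leq_ltn_trans _ ltSD).
  - move=> S'; rewrite subsetD => /andP[sS'D disS'].
    rewrite -(leq_add2l #|S|).
    have -> : #|S| + #|S'| = #|S :|: S'|.
      rewrite cardsU; move: disS'; rewrite -setI_eq0 setIC => /eqP->.
      by rewrite cards0 subn0.
    apply: leq_trans (hallq _ _) _; first by rewrite subUset sSD.
    apply: leq_trans (leq_add leNS (leqnn _)).
    apply: leq_trans (leq_card_setU _ _); apply: subset_leq_card.
    apply/subsetP=> y; rewrite !inE => /existsP[x /andP[]].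
    have [NSy _ _|/negbTE nNSy] := boolP (y \in N S).
      by move: NSy; rewrite inE => ->.
    rewrite inE => /orP[Sx|S'x] qxy; last first.
      by apply/orP; right; apply/existsP; exists x; rewrite S'x qxy inE in nNSy *; rewrite nNSy.
    by case/negP: (negbT nNSy); rewrite inE; apply/existsP; exists x; rewrite Sx.
  exists (fun x => if x \in S then f x else g x) => [x y Dx Dy|x Dx] /=; last first.
    case: ifPn => [/qf//|nSx].
    by have /andP[] := qg x (introT setDP (conj Dx nSx)).
  have fgF u v : u \in S -> v \in D -> v \notin S -> f u <> g v.
    move=> Su Dv nSv fg.
    have /andP[_ /negP[]] := qg v (introT setDP (conj Dv nSv)).
    by rewrite -fg inE; apply/existsP; exists u; rewrite Su qf.
  case: ifPn => Sx; case: ifPn => Sy.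
  - exact: injf.
  - by move/fgF=> [].
  - by move/esym/fgF=> [].
  - by apply: injg; rewrite inE ?Sx ?Sy.
have [y0 qxy0] : exists y0, q x0 y0.
  have : 0 < #|N [set x0]| by apply: leq_trans (hallq _ _); rewrite ?cards1 ?sub1set.
  case/card_gt0P=> y; rewrite inE => /existsP[x /andP[]].
  by rewrite inE => /eqP-> qy; exists y.
(* No set is tight, so removing [y0] costs each [S] at most its spare neighbour. *)
have [||f injf qf] := IHn (D :\ x0) (fun x y => q x y && (y != y0)).
- by rewrite -ltnS (leq_trans _ leDn) // (cardsD1 x0 D) Dx0.
- move=> S; rewrite subsetD1 => /andP[sSD nSx0].
  have [->|nS0] := eqVneq S set0; first by rewrite cards0.
  have ltNS : #|S| < #|N S|.
    have nSD : S != D by apply: contraNneq nSx0 => ->.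
    by move: (noS S); rewrite sSD nS0 nSD /= -ltnNge.
  rewrite -ltnS; apply: leq_trans ltNS _.
  rewrite (cardsD1 y0 (N S)) -add1n leq_add ?leq_b1 // subset_leq_card //.
  apply/subsetP=> y; rewrite !inE => /andP[ny0 /existsP[x /andP[Sx qxy]]].
  by apply/existsP; exists x; rewrite Sx qxy.
exists (fun x => if x == x0 then y0 else f x) => [x y Dx Dy|x Dx] /=; last first.
  case: eqP => [->//|/eqP nx]; have /andP[] // : q x (f x) && (f x != y0).
  by apply: qf; rewrite !inE nx.
have fN u : u \in D -> u != x0 -> f u != y0.
  by move=> Du nu; have /andP[] // : q u (f u) && (f u != y0) by apply: qf; rewrite !inE nu.
case: eqP => [->|/eqP nx]; case: eqP => [->|/eqP ny] //.
- by move/esym/eqP; rewrite (negbTE (fN _ Dy ny)).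
- by move/eqP; rewrite (negbTE (fN _ Dx nx)).
- by apply: injf; rewrite !inE ?nx ?ny.
Qed.

(** A permutation agreeing with [m] at the most points works: if [m x y] but s x <> y, composing
    with the transposition of [s x] and [y] gains the point [x] and, [m] being a matching, loses
    none. *)
Lemma matching_extends_perm (T : finType) (m : rel T) :
  (forall x y y', m x y -> m x y' -> y = y') ->
  (forall x x' y, m x y -> m x' y -> x = x') ->
  exists s : {perm T}, forall x y, m x y -> s x = y.
Proof.
move=> mfun minj.
pose A (s : {perm T}) := [set x | m x (s x)].
have [s _ maxs] := @arg_maxnP _ (1%g : {perm T}) xpredT (fun s => #|A s|) isT.
exists s => x y mxy; apply/eqP; apply/negPn/negP => /eqP nsxy.
have := maxs (s * tperm (s x) y)%g isT; rewrite /= leqNgt => /negP[].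
apply: proper_card; apply/properP; split; last first.
  exists x; first by rewrite inE permM tpermL.
  by rewrite inE; apply/negP => /mfun/(_ mxy).
apply/subsetP=> z; rewrite !inE permM => mz.
rewrite tpermD // eq_sym.
  by apply/eqP => /perm_inj zx; rewrite zx in mz; apply: nsxy; apply: mfun mz mxy.
by apply/eqP => zy; rewrite zy in mz; move: mz nsxy => /minj/(_ mxy)<-.
Qed.

(** * Packings as permutations; monotonicity in the number of colours *)

(** The j-th colouring gives [v] the colour [r v j]; disjointness of the colourings makes [r v]
    injective, hence a permutation. *)
Lemma packingP (V : finType) (k : nat) (H : rel (V * 'I_k)) :
  (exists P, correspondence_packing H P) <->
  (exists r : V -> {perm 'I_k}, forall j u v, ~~ H (u, r u j) (v, r v j)).
Proof.
split=> [[P [colP disP]]|[r Hr]].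
  have colour v : exists s : {perm 'I_k}, forall j, (v, s j) \in P j.
    have colour_at j : exists c, (v, c) \in P j.
      have [_ /(_ v)/eqP/cards1P[[w c] /setP/(_ (w, c))]] := colP j.
      by rewrite !inE eqxx => /andP[Pwc /eqP <-]; exists c.
    have [f Pf] := fin_all_exists colour_at.
    have injf : injective f.
      move=> i j fij; apply/eqP; apply/negPn/negP => /disP/pred0P/(_ (v, f i)).
      by rewrite /= Pf fij Pf.
    by exists (perm injf) => j; rewrite permE.
  have [r Pr] := fin_all_exists colour.
  by exists r => j u v; have [indep _] := colP j; apply: indep.
exists (fun j => [set x | x.2 == r x.1 j]); split=> [i|i j nij]; last first.
  apply/pred0P=> -[v c] /=; rewrite !inE /=; apply/negP => /andP[/eqP-> /eqP].
  by move/perm_inj/eqP; rewrite (negbTE nij).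
split=> [[u a] [v b]|v]; first by rewrite !inE /= => /eqP-> /eqP->.
apply/eqP/cards1P; exists (v, r v i); apply/setP=> -[u a]; rewrite !inE /=.
by rewrite xpair_eqE andbC; case: eqP => //= ->.
Qed.

(** When [f v] skips one colour, this restricts a cover to the other colours at each vertex. *)
Lemma cover_pullback (V : finType) (G : rel V) (k l : nat)
    (H : rel (V * 'I_l)) (f : V -> 'I_k -> 'I_l) :
  (forall v, injective (f v)) -> correspondence_cover G H ->
  correspondence_cover G (fun x y => H (x.1, f x.1 x.2) (y.1, f y.1 y.2)).
Proof.
move=> injf [[symH irrH] indepH nonH matchH]; split.
- by split=> [x y|x]; [apply: symH | apply: irrH].
- by move=> v x y; rewrite !inE => xv yv; apply: (indepH v); rewrite inE.
- by move=> u v nG x y; rewrite !inE => xu yv; apply: (nonH u v nG); rewrite inE.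
- move=> u v Guv [a1 a] [b1 b] [a1' a'] [b1' b'].
  rewrite !inE /= => /eqP-> /eqP-> /eqP-> /eqP-> Hab Hab' neq.
  have [na nb] : (u, f u a) <> (u, f u a') /\ (v, f v b) <> (v, f v b').
    apply: (matchH u v Guv); rewrite ?inE //= => -[/injf ea /injf eb].
    by apply: neq; rewrite ea eb.
  by split=> -[e]; [apply: na | apply: nb]; rewrite e.
Qed.

(* Remove one colouring, found in a k-fold subcover; what is left is a k-fold
   cover. *)
Lemma packableS (V : finType) (G : rel V) (k : nat) :
  0 < k -> packable G k -> packable G k.+1.
Proof.
case: k => // k _ pack H covH.
have [|r1 Hr1] := (packingP _).1 (pack _ (cover_pullback (f := fun=> lift ord0) _ covH)).
  by move=> _; apply: lift_inj.
(* The removed colouring is the first one in a packing of the subcover omitting colour 0; it exists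
   because that subcover has at least one colour. *)
pose c v := lift ord0 (r1 v ord0).
have [|r2 Hr2] := (packingP _).1 (pack _ (cover_pullback (f := fun v => lift (c v)) _ covH)).
  by move=> v; apply: lift_inj.
apply/packingP; exists (fun v => lift_perm ord0 (c v) (r2 v)) => j u v.
have [j' ->|->] := unliftP ord0 j; last by rewrite !lift_perm_id; apply: Hr1.
by rewrite !lift_perm_lift; apply: Hr2.
Qed.

Lemma packableW (V : finType) (G : rel V) (k l : nat) :
  0 < k -> k <= l -> packable G k -> packable G l.
Proof.
move=> k0 /subnKC <-; elim: (l - k) => [|i IHi]; first by rewrite addn0.
by move=> /IHi; rewrite addnS; apply: packableS; rewrite addn_gt0 k0.
Qed.

(** * Reduction for complete bipartite graphs to products of permutations *)

Definition perm_family (d k : nat) := {ffun 'I_d -> {perm 'I_k}}.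

(** Here [r i j] is the colour that the i-th neighbour forbids to the j-th colouring, and [s] lists
    the colours chosen at the vertex itself. *)
Definition avoidable d k (r : perm_family d k) : bool :=
  [exists s : {perm 'I_k}, forall i, forall j, r i j != s j].

Definition family_mul d k (p q : perm_family d k) : perm_family d k :=
  [ffun i => (p i * q i)%g].

Lemma packable_bipartiteP d t k :
  packable (@complete_bipartite d t) k <->
  (forall q : {ffun 'I_t -> perm_family d k},
     exists p, forall b, avoidable (family_mul p (q b))).
Proof.
split=> [pack q|ext H [[symH irrH] indepH nonH matchH]].
  pose H : rel (('I_d + 'I_t) * 'I_k) := fun x y =>
    match x.1, y.1 with
    | inl i, inr b => q b i x.2 == y.2
    | inr b, inl i => q b i y.2 == x.2
    | _, _ => false
    end.
  have covH : correspondence_cover (@complete_bipartite d t) H.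
    split.
    - by split=> [[[i|b] x] [[i'|b'] y]|[[i|b] x]].
    - by move=> [i|b] [[i1|b1] x] [[i2|b2] y]; rewrite !inE /H.
    - move=> u v + [u' x] [v' y]; rewrite !inE /= => + /eqP-> /eqP->.
      by case: u v => [i|b] [i'|b'].
    - move=> u v + [u1 x] [v1 y] [u2 x'] [v2 y'].
      rewrite !inE /= => + /eqP-> /eqP-> /eqP-> /eqP->.
      case: u v => [i|b] [i'|b'] //= _; rewrite /H /= => /eqP exy /eqP exy' neq.
        split=> -[e]; apply: neq; first by rewrite -exy -exy' e.
        by move: e; rewrite -exy -exy' => /perm_inj->.
      split=> -[e]; apply: neq; last by rewrite -exy -exy' e.
      by move: e; rewrite -exy -exy' => /perm_inj->.
  have [r Hr] := (packingP _).1 (pack H covH).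
  exists [ffun i => r (inl i)] => b; apply/existsP; exists (r (inr b)).
  by apply/forallP=> i; apply/forallP=> j; rewrite !ffunE permM; apply: (Hr j (inl i) (inr b)).
(* Each matching is completed to a perfect one: a packing that avoids the larger set of edges avoids
   the given ones. *)
have extend b i : exists s : {perm 'I_k},
    forall x y, H (inl i, x) (inr b, y) -> s x = y.
  apply: matching_extends_perm => [x y y' Hxy Hxy'|x x' y Hxy Hxy'];
    apply/eqP; apply/negPn/negP => /eqP neq.
    have [] // : (@inl 'I_d 'I_t i, x) <> (inl i, x) /\ (@inr 'I_d 'I_t b, y) <> (inr b, y').
    by apply: (matchH (inl i) (inr b) isT _ _ _ _ _ _ _ _ Hxy Hxy'); rewrite ?inE // => -[].
  have [] // : (@inl 'I_d 'I_t i, x) <> (inl i, x') /\ (@inr 'I_d 'I_t b, y) <> (inr b, y).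
  by apply: (matchH (inl i) (inr b) isT _ _ _ _ _ _ _ _ Hxy Hxy'); rewrite ?inE // => -[].
have [q0 Hq0] := fin_all_exists (fun b => fin_all_exists (extend b)).
have [p pP] := ext [ffun b => [ffun i => q0 b i]].
have [s sP] := fin_all_exists (fun b => existsP (pP b)).
have Hps j i b : ~~ H (inl i, p i j) (inr b, s b j).
  apply/negP => /Hq0 E; have /forallP/(_ i)/forallP/(_ j) := sP b.
  by rewrite !ffunE permM E eqxx.
apply/packingP; exists (fun v => match v with inl i => p i | inr b => s b end).
move=> j [i|b] [i'|b'] //.
- by apply: (nonH (inl i) (inl i')); rewrite ?inE.
- by rewrite symH.
- by apply: (nonH (inr b) (inr b')); rewrite ?inE.
Qed.

(** * Covered rectangles as obstructions to avoidance *)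

Definition covers d k (S T : {set 'I_k}) (r : perm_family d k) : bool :=
  [forall x in S, forall y in T, exists i, r i x == y].

Lemma coversP d k (S T : {set 'I_k}) (r : perm_family d k) :
  reflect {in S & T, forall x y, exists i, r i x = y} (covers S T r).
Proof.
apply: (iffP forall_inP) => [h x y Sx Ty|h x Sx].
  by have /forall_inP/(_ y Ty)/existsP[i /eqP] := h x Sx; exists i.
by apply/forall_inP=> y Ty; apply/existsP; have [i <-] := h x y Sx Ty; exists i.
Qed.

Section Covers.
Variables (d k : nat) (S T : {set 'I_k}) (r : perm_family d k).
Hypothesis cov : covers S T r.

Lemma covers_sub_image x : x \in S -> T \subset [set r i x | i : 'I_d].
Proof.
move=> Sx; apply/subsetP=> y Ty.
by have [i <-] := coversP _ _ _ cov x y Sx Ty; apply/imsetP; exists i.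
Qed.

Lemma covers_sub_preimage y : y \in T -> S \subset [set (r i)^-1%g y | i : 'I_d].
Proof.
move=> Ty; apply/subsetP=> x Sx.
have [i <-] := coversP _ _ _ cov x y Sx Ty.
by apply/imsetP; exists i; rewrite ?permK.
Qed.

(** A row takes at most d values, so a d-element [T] is all of it; that one row determines [T] later
    gives uniqueness of the rectangle. *)
Lemma covers_image x : #|T| = d -> x \in S -> T = [set r i x | i : 'I_d].
Proof.
move=> cT Sx; apply/eqP; rewrite eqEcard covers_sub_image //= cT.
by rewrite -[leqRHS]card_ord leq_imset_card.
Qed.

Lemma covers_preimage y : #|S| = d -> y \in T -> S = [set (r i)^-1%g y | i : 'I_d].
Proof.
move=> cS Ty; apply/eqP; rewrite eqEcard covers_sub_preimage //= cS.
by rewrite -[leqRHS]card_ord leq_imset_card.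
Qed.

End Covers.

(** A permutation avoiding [r] would send [S] injectively into the complement of [T], which is too
    small. *)
Lemma covers_unavoidable d k (S T : {set 'I_k}) (r : perm_family d k) :
  covers S T r -> k < #|S| + #|T| -> ~~ avoidable r.
Proof.
move=> /coversP cov lt; apply/existsPn=> s; apply/negP => /forallP sP.
suff sub : s @: S \subset ~: T.
  move: (subset_leq_card sub); rewrite card_imset; last exact: perm_inj.
  rewrite [in leqRHS]cardsCs setCK card_ord leqNgt ltn_subLR.
    by rewrite addnC lt.
  by rewrite -[leqRHS]card_ord max_card.
apply/subsetP=> _ /imsetP[x Sx ->]; rewrite inE; apply/negP => Tsx.
have [i E] := cov x _ Sx Tsx.
by have /forallP/(_ x) := sP i; rewrite E eqxx.
Qed.

(** Hall's condition fails for the relation of allowed pairs: [S] is a violating set and [T] the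
    complement of its neighbourhood. The bounds by d hold because a row or column of [r] takes at
    most d values. *)
Lemma unavoidable_covers d k (r : perm_family d k) :
  ~~ avoidable r ->
  exists S T : {set 'I_k},
    [/\ covers S T r, k < #|S| + #|T|, #|S| <= d & #|T| <= d].
Proof.
move=> nav.
pose e : rel 'I_k := fun x y => [forall i, r i x != y].
pose N (S : {set 'I_k}) := [set y | [exists x in S, e x y]].
have [/existsP[S ltNS]|/existsPn hallS] := boolP [exists S, #|N S| < #|S|]; last first.
  have [|s sP] := @hall _ e; first by move=> S; rewrite leqNgt hallS.
  case/negP: nav; apply/existsP; exists s; apply/forallP=> i; apply/forallP=> x.
  by have /forallP := sP x; apply.
have cov : covers S (~: N S) r.
  apply/coversP=> x y Sx; rewrite !inE negb_exists => /forallP/(_ x).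
  by rewrite Sx /= negb_forall => /existsP[i /negPn/eqP]; exists i.
have cardN := cardsC (N S); rewrite card_ord in cardN.
have leSk : #|S| <= k by rewrite -[leqRHS]card_ord max_card.
have S0 : 0 < #|S| by apply: leq_ltn_trans ltNS.
have T0 : 0 < #|~: N S|.
  by rewrite lt0n; apply: contraTneq ltNS => T0; rewrite -leqNgt; rewrite T0 addn0 in cardN; rewrite cardN.
exists S, (~: N S); split=> //.
- by rewrite -[ltnLHS]cardN ltn_add2r.
- have /card_gt0P[y Ty] := T0; apply: leq_trans (subset_leq_card (covers_sub_preimage cov Ty)) _.
  by rewrite -[leqRHS]card_ord leq_imset_card.
- have /card_gt0P[x Sx] := S0; apply: leq_trans (subset_leq_card (covers_sub_image cov Sx)) _.
  by rewrite -[leqRHS]card_ord leq_imset_card.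
Qed.

Lemma avoidable_double d (r : perm_family d (2 * d)) : avoidable r.
Proof.
apply: contraT => /unavoidable_covers[S [T [_ lt leS leT]]].
by have := leq_trans lt (leq_add leS leT); rewrite addnn -mul2n ltnn.
Qed.

(** * Latin squares as families of permutations *)

Definition latin_families d : {set perm_family d d} :=
  [set r : perm_family d d | [forall x, injectiveb (fun i => r i x)]].

Lemma card_latin_families d : #|latin_families d| = num_latin_squares d.
Proof.
pose mx (r : perm_family d d) : 'M['I_d]_d := (\matrix_(i, j) r i j)%R.
have mx_inj : injective mx.
  move=> p q /matrixP E; apply/ffunP=> i; apply/permP=> x.
  by have := E i x; rewrite !mxE.
rewrite -(card_imset _ mx_inj); apply: eq_card => M; rewrite !inE.
apply/imsetP/andP=> [[r] + ->|[/forallP rowM /forallP colM]].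
  rewrite inE => /forallP latr; split; apply/forallP=> i; apply/injectiveP.
    by move=> j j'; rewrite !mxE => /perm_inj.
  by move=> j j'; rewrite !mxE; apply: (injectiveP _ (latr i)).
exists [ffun i => perm (injectiveP _ (rowM i))]; last first.
  by apply/matrixP=> i j; rewrite mxE ffunE permE.
rewrite inE; apply/forallP=> x; apply/injectiveP=> i j; rewrite !ffunE !permE.
exact: (injectiveP _ (colM x)).
Qed.

Lemma num_latin_squares_gt0 d : 0 < num_latin_squares d.
Proof.
case: d => [|d]; apply/card_gt0P.
  exists (\matrix_(i, j) i)%R; rewrite inE.
  by apply/andP; split; apply/forallP=> -[].
(* The addition table of a cyclic group. *)
exists (\matrix_(i, j) (i + j))%R; rewrite inE.
apply/andP; split; apply/forallP=> x; apply/injectiveP=> i j; rewrite !mxE.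
  exact: addrI.
exact: addIr.
Qed.

(** * Counting the families that cover a given d x d rectangle *)

Section Blocks.
Variables d m : nat.

Definition block_fun (a : {perm 'I_d}) (b : {perm 'I_m}) (x : 'I_(d + m)) :
    'I_(d + m) :=
  unsplit (match split x with inl y => inl (a y) | inr z => inr (b z) end).

Lemma block_fun_inj a b : injective (block_fun a b).
Proof.
move=> x y /(can_inj unsplitK); rewrite -{2}[x]splitK -{2}[y]splitK.
by case: split => ?; case: split => ? // [/perm_inj->].
Qed.

Definition block_perm a b : {perm 'I_(d + m)} := perm (@block_fun_inj a b).

Lemma block_perm_lshift a b x : block_perm a b (lshift m x) = lshift m (a x).
Proof. by rewrite permE /block_fun (unsplitK (inl x)). Qed.

Lemma block_perm_rshift a b x : block_perm a b (rshift d x) = rshift d (b x).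
Proof. by rewrite permE /block_fun (unsplitK (inr x)). Qed.

Definition lblock : {set 'I_(d + m)} := [set lshift m x | x : 'I_d].

Lemma card_lblock : #|lblock| = d.
Proof. by rewrite card_imset ?card_ord //; apply: lshift_inj. Qed.

Lemma block_permP (s : {perm 'I_(d + m)}) :
  s @: lblock = lblock -> exists a b, s = block_perm a b.
Proof.
move=> stab.
have sl x : exists y, s (lshift m x) = lshift m y.
  have /imsetP[y _ ->] : s (lshift m x) \in lblock.
    by rewrite -stab !imset_f.
  by exists y.
have sr x : exists y, s (rshift d x) = rshift d y.
  have [y E|y ->] := split_ordP (s (rshift d x)); last by exists y.
  have : s (rshift d x) \in s @: lblock by rewrite stab E imset_f.
  rewrite (mem_imset _ _ (@perm_inj _ s)) => /imsetP[z _ /eqP].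
  by rewrite eq_rlshift.
have [a sa] := fin_all_exists sl; have [b sb] := fin_all_exists sr.
have inja : injective a.
  by move=> x y exy; apply/(@lshift_inj d m)/(@perm_inj _ s); rewrite !sa exy.
have injb : injective b.
  by move=> x y exy; apply/(@rshift_inj d m)/(@perm_inj _ s); rewrite !sb exy.
exists (perm inja), (perm injb); apply/permP=> x.
case: (split_ordP x) => y ->.
  by rewrite block_perm_lshift permE.
by rewrite block_perm_rshift permE.
Qed.

(** Covering forces every [r i] to stabilise the block; the restrictions to it form a Latin family,
    and the action on the other m colours is arbitrary. *)
Lemma card_covers_lblock :
  #|[set r : perm_family d (d + m) | covers lblock lblock r]|
    = num_latin_squares d * m`! ^ d.
Proof.
pose blocks (p : perm_family d d * perm_family d m) : perm_family d (d + m) :=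
  [ffun i => block_perm (p.1 i) (p.2 i)].
have blocks_inj : injective blocks.
  move=> [a b] [a' b'] /ffunP E; congr (_, _); apply/ffunP=> i; apply/permP=> x.
    have /permP/(_ (lshift m x)) := E i.
    by rewrite !ffunE !block_perm_lshift => /lshift_inj.
  have /permP/(_ (rshift d x)) := E i.
  by rewrite !ffunE !block_perm_rshift => /rshift_inj.
have -> : m`! ^ d = #|[set: perm_family d m]|.
  by rewrite cardsT card_ffun card_Sn card_ord.
rewrite -card_latin_families -cardsX -(card_imset _ blocks_inj).
apply: eq_card => r; rewrite inE; apply/idP/imsetP.
  move=> cov.
  have stab i : r i @: lblock = lblock.
    apply/eqP; rewrite eqEcard (card_imset _ (@perm_inj _ (r i))) leqnn andbT.
    apply/subsetP=> _ /imsetP[x Sx ->].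
    by rewrite [in X in _ \in X](covers_image cov card_lblock Sx) imset_f.
  have [a Ha] := fin_all_exists (fun i => block_permP (stab i)).
  have [b Hab] := fin_all_exists Ha.
  exists ([ffun i => a i], [ffun i => b i]); last first.
    by apply/ffunP=> i; rewrite !ffunE Hab.
  rewrite in_setX in_setT andbT inE; apply/forallP=> x.
  apply/injectiveP=> i j; rewrite /= !ffunE => eij.
  (* The d values [r i x] fill a block of d elements, so they are distinct. *)
  have /imset_injP inj : #|[set r i (lshift m x) | i : 'I_d]| == #|'I_d|.
    rewrite -(covers_image cov card_lblock) ?imset_f //.
    by rewrite card_lblock card_ord.
  by apply: inj; rewrite // !Hab !block_perm_lshift eij.
case=> -[a b]; rewrite in_setX => /andP[+ _]; rewrite inE /= => /forallP lat ->.
apply/coversP=> _ _ /imsetP[x _ ->] /imsetP[y _ ->].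
exists (invF (injectiveP _ (lat x)) y).
by rewrite ffunE block_perm_lshift (f_invF (injectiveP _ (lat x))).
Qed.

End Blocks.

(** Elements of equal rank in the two enumerations are paired, and this partial matching is
    extended. *)
Lemma perm_onto_set (T : finType) (A B : {set T}) :
  #|A| = #|B| -> exists s : {perm T}, s @: A = B.
Proof.
move=> cAB.
have [||s sP] := @matching_extends_perm T
    (fun x y => [&& x \in A, y \in B & index x (enum A) == index y (enum B)]).
- move=> x y y' /and3P[_ By /eqP E] /and3P[_ By' /eqP E'].
  by apply: (@index_inj _ y (enum B)); rewrite ?mem_enum // -E.
- move=> x x' y /and3P[Ax _ /eqP E] /and3P[Ax' _ /eqP E'].
  by apply: (@index_inj _ x (enum A)); rewrite ?mem_enum // E.
exists s; apply/eqP; rewrite eqEcard card_imset ?cAB ?leqnn ?andbT; last exact: perm_inj.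
apply/subsetP=> _ /imsetP[x Ax ->].
have ltx : index x (enum A) < size (enum B) by rewrite -cardE -cAB cardE index_mem mem_enum.
have By : nth x (enum B) (index x (enum A)) \in B by rewrite -mem_enum mem_nth.
by rewrite (sP x (nth x (enum B) (index x (enum A)))) // Ax By index_uniq ?enum_uniq /=.
Qed.

(** Composing with permutations that carry the standard block to [S] and to [T] is a bijection of
    families, reducing to the block. *)
Lemma card_covers d m (S T : {set 'I_(d + m)}) :
  #|S| = d -> #|T| = d ->
  #|[set r : perm_family d (d + m) | covers S T r]|
    = num_latin_squares d * m`! ^ d.
Proof.
move=> cS cT.
have [s sS] := perm_onto_set (etrans (card_lblock d m) (esym cS)).
have [u uT] := perm_onto_set (etrans (card_lblock d m) (esym cT)).
pose conj (r : perm_family d (d + m)) : perm_family d (d + m) :=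
  [ffun i => (s * r i * u^-1)%g].
have conj_inj : injective conj.
  move=> p q /ffunP E; apply/ffunP=> i; have := E i; rewrite !ffunE.
  by move/mulIg/mulgI.
rewrite -card_covers_lblock -[RHS](card_preimset _ conj_inj).
apply: eq_card => r; rewrite !inE; apply/coversP/coversP.
  move=> cov x y Sx Sy; have [||i E] := cov (s x) (u y); rewrite -?sS -?uT ?imset_f //.
  by exists i; rewrite ffunE !permM E permK.
move=> cov; rewrite -sS -uT => _ _ /imsetP[x Sx ->] /imsetP[y Sy ->].
have [i Ei] := cov x y Sx Sy; exists i.
by apply: (@perm_inj _ u^-1%g); rewrite permK -Ei ffunE !permM.
Qed.

(** * Counting the unavoidable families for 2d - 1 colours *)

Lemma card_perm_family d k : #|{: perm_family d k}| = k`! ^ d.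
Proof. by rewrite card_ffun card_Sn card_ord. Qed.

Lemma card_unavoidable d m : d = m.+1 ->
  #|[set r : perm_family d (d + m) | ~~ avoidable r]| =
    'C(d + m, d) ^ 2 * m`! ^ d * num_latin_squares d.
Proof.
move=> dE.
pose D : {set {set 'I_(d + m)}} := [set A : {set 'I_(d + m)} | #|A| == d].
(* [F] is empty off [setX D D], so that the disjoint union can run over all pairs. *)
pose F (ST : {set 'I_(d + m)} * {set 'I_(d + m)}) :=
  [set r : perm_family d (d + m) | (ST \in setX D D) && covers ST.1 ST.2 r].
have meet (A B : {set 'I_(d + m)}) : #|A| = d -> #|B| = d -> exists2 x, x \in A & x \in B.
  move=> cA cB; suff /card_gt0P[x] : 0 < #|A :&: B| by rewrite inE => /andP[]; exists x.
  have := leq_trans (max_card (A :|: B)) (eq_leq (card_ord _)).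
  by rewrite cardsU cA cB; lia.
have -> : [set r : perm_family d (d + m) | ~~ avoidable r] = \bigcup_ST F ST.
  apply/setP=> r; rewrite inE; apply/idP/bigcupP.
    move=> /unavoidable_covers[S [T [cov lt leS leT]]]; exists (S, T) => //.
    have [cS cT] : #|S| = d /\ #|T| = d by lia.
    by rewrite !inE cov /= cS cT eqxx.
  move=> [[S T] _]; rewrite !inE /= => /andP[/andP[/eqP cS /eqP cT] cov].
  by apply: (covers_unavoidable cov); rewrite cS cT dE; lia.
rewrite -sum1_card partition_disjoint_bigcup.
  have -> : 'C(d + m, d) ^ 2 * m`! ^ d * num_latin_squares d =
            \sum_(ST in setX D D) num_latin_squares d * m`! ^ d.
    by rewrite sum_nat_const cardsX card_draws card_ord mulnn -mulnA [m`! ^ d * _]mulnC.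
  rewrite [RHS]big_mkcond; apply: eq_bigr => -[S T] _; rewrite sum1_card.
  case: ifPn => [DST|/negbTE nDST].
    have := DST; rewrite !inE /= => /andP[/eqP cS /eqP cT].
    by rewrite -(card_covers cS cT); apply: eq_card => r; rewrite !inE /= cS cT eqxx.
  by apply: eq_card0 => r; rewrite [r \in _]inE nDST.
(* Disjointness: two d-subsets of 2d - 1 points meet, so a common row gives T = T', and then a
   common column gives S = S'. *)
move=> [S T] [S' T'] neq; apply/pred0P=> r /=; apply/negP => /andP[].
rewrite !inE /= => /andP[/andP[/eqP cS /eqP cT] cov] /andP[/andP[/eqP cS' /eqP cT'] cov'].
case/eqP: neq; have [x Sx S'x] := meet S S' cS cS'.
have ET : T = T' by rewrite (covers_image cov cT Sx) (covers_image cov' cT' S'x).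
have /card_gt0P[y Ty] : 0 < #|T| by rewrite cT dE.
rewrite (covers_preimage cov cS Ty) -ET; congr (_, _).
by rewrite ET in Ty; rewrite (covers_preimage cov' cS' Ty).
Qed.

(** * The two union bounds, by double counting *)

Lemma family_mulI d k (p : perm_family d k) : injective (family_mul p).
Proof.
move=> q q' /ffunP E; apply/ffunP=> i.
by have := E i; rewrite !ffunE => /mulgI.
Qed.

Lemma family_mulIg d k (q : perm_family d k) : injective (fun p => family_mul p q).
Proof.
move=> p p' /ffunP E; apply/ffunP=> i.
by have := E i; rewrite !ffunE => /mulIg.
Qed.

(** If no [p] suited [q], every [p] would occur in a pair (p, b) with unavoidable product; yet each
    [b] lies in exactly as many such pairs as there are unavoidable families. *)
Lemma packable_of_few_unavoidable d t k :
  t * #|[set r : perm_family d k | ~~ avoidable r]| < k`! ^ d ->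
  packable (@complete_bipartite d t) k.
Proof.
move=> lt; apply/packable_bipartiteP => q; apply: contrapT => /forallNP noext.
move: lt; apply/negP; rewrite -leqNgt -card_perm_family -[leqLHS]sum1_card.
have -> : t * #|[set r : perm_family d k | ~~ avoidable r]| =
    \sum_(b < t) \sum_(p : perm_family d k) ~~ avoidable (family_mul p (q b)).
  rewrite -[X in X * _](card_ord t) -sum_nat_const; apply: eq_bigr => b _.
  rewrite -(card_preimset _ (@family_mulIg _ _ (q b))) -sum1_card big_mkcond.
  by apply: eq_bigr => p _; rewrite !inE; case: avoidable.
rewrite exchange_big; apply: leq_sum => p _.
have [b nav] : exists b, ~~ avoidable (family_mul p (q b)).
  by apply/existsP; rewrite -negb_forall; apply/negP => /forallP/(noext p).
by rewrite (bigD1 b) //= nav.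
Qed.

(** Pairs (p, q) where [p] extends to every [b] are counted: each [q] has at least one [p], and each
    [p] has exactly as many [q] as there are t-tuples of avoidable families. *)
Lemma card_avoidable_of_packable d t k :
  packable (@complete_bipartite d t) k ->
  (k`! ^ d) ^ t <= k`! ^ d * #|[set r : perm_family d k | avoidable r]| ^ t.
Proof.
move=> /packable_bipartiteP ext.
have -> : (k`! ^ d) ^ t = \sum_(q : {ffun 'I_t -> perm_family d k}) 1.
  by rewrite sum1_card card_ffun card_ord card_perm_family.
have -> : k`! ^ d * #|[set r : perm_family d k | avoidable r]| ^ t =
    \sum_(p : perm_family d k) \sum_(q : {ffun 'I_t -> perm_family d k})
      [forall b, avoidable (family_mul p (q b))].
  rewrite -card_perm_family -sum_nat_const; apply: eq_bigr => p _.
  rewrite -(card_preimset _ (@family_mulI _ _ p)) -[X in _ ^ X](card_ord t) -card_ffun_on.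
  rewrite -sum1_card big_mkcond; apply: eq_bigr => q _.
  have -> : [forall b, avoidable (family_mul p (q b))] =
    (q \in ffun_on (family_mul p @^-1: [set r | avoidable r])).
    by apply: eq_forallb => b; rewrite !inE.
  by case: ifP.
rewrite exchange_big; apply: leq_sum => q _.
have [p pP] := ext q.
rewrite (bigD1 p) //=.
by have /forallP-> := pP.
Qed.

(** * The packing number and the two thresholds *)

Lemma packing_number_exists (V : finType) (G : rel V) k :
  0 < k -> packable G k ->
  exists2 l, correspondence_packing_number G l & l <= k.
Proof.
move=> k0 packk.
have exP : exists l, (0 < l) && `[< packable G l >].
  by exists k; rewrite k0; apply/asboolP.
case: (ex_minnP exP) => l /andP[l0 /asboolP packl] minl.
exists l; last by apply: minl; rewrite k0; apply/asboolP.
by split=> // j j0 packj; apply: minl; rewrite j0; apply/asboolP.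
Qed.

(** Combines 1 - p < exp(-p), strict as p <> 0, with N = exp(ln N); t > 0 keeps the power strict. *)
Lemma one_sub_pow_lt (R : realType) (N p : R) (t : nat) :
  (0 < t)%N -> (0 < N -> 0 < p -> p <= 1 -> ln N <= p * t%:R ->
  N * (1 - p) ^+ t < 1)%R.
Proof.
move=> t0 N0 p0 p1 lnN.
have lt : ((1 - p) ^+ t < expR (- (p * t%:R)))%R.
  rewrite -mulNr expRM_natr ltrXn2r ?subr_ge0 ?expR_ge0 -?lt0n //.
  by rewrite expR_gt1Dx // oppr_eq0 gt_eqF.
apply: lt_le_trans (_ : N * expR (- (p * t%:R)) <= _)%R.
  by rewrite ltr_pM2l.
rewrite -{1}(lnK (x := N)) ?posrE // -expRD -[leRHS]expR0 ler_expR.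
by rewrite subr_le0.
Qed.

Theorem theorem2 (R : realType) (d : nat) (hd : 0 < d) (t : nat) (ht : 0 < t) :
  ((t%:R < xthreshold R d)%R ->
     exists2 k, correspondence_packing_number (@complete_bipartite d t) k
              & k < 2 * d) /\
  ((xthreshold R d * (d%:R * ln ((2 * d - 1)`!)%:R) <= t%:R)%R ->
     correspondence_packing_number (@complete_bipartite d t) (2 * d)).
Proof.
rewrite /xthreshold.
have k0 : 0 < 2 * d - 1 by lia.
pose X := (2 * d - 1)`! ^ d.
pose bad := 'C(2 * d - 1, d) ^ 2 * (d - 1)`! ^ d * num_latin_squares d.
have X0 : 0 < X by rewrite expn_gt0 fact_gt0.
have bad0 : 0 < bad.
  by rewrite !muln_gt0 !expn_gt0 fact_gt0 num_latin_squares_gt0 bin_gt0; lia.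
have cbad : #|[set r : perm_family d (2 * d - 1) | ~~ avoidable r]| = bad.
  have dE : d = (d - 1).+1 by lia.
  have := card_unavoidable dE.
  by rewrite (_ : d + (d - 1) = 2 * d - 1) //; lia.
rewrite -/X -/bad; split=> [lt|le].
  have [||l numl ll] := @packing_number_exists _ (@complete_bipartite d t) (2 * d - 1) => //.
    apply: packable_of_few_unavoidable; rewrite cbad.
    by move: lt; rewrite ltr_pdivlMr ?ltr0n // -natrM ltr_nat.
  by exists l => //; lia.
(* By monotonicity in the number of colours, minimality of 2d reduces to this case. *)
have npack : ~ packable (@complete_bipartite d t) (2 * d - 1).
  move=> /card_avoidable_of_packable.
  have cgood : #|[set r : perm_family d (2 * d - 1) | avoidable r]| = X - bad.
    rewrite /X -card_perm_family -cbad -[#|{: _}|](cardsC [set r | avoidable r]).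
    rewrite [X in _ + X - _](_ : _ = #|[set r : perm_family d (2 * d - 1) | ~~ avoidable r]|).
      by rewrite addnK.
    by apply: eq_card => r; rewrite !inE.
  have leX : bad <= X by rewrite -cbad /X -card_perm_family max_card.
  rewrite cgood -/X leqNgt => /negP[].
  have lnX : (ln X%:R = d%:R * ln ((2 * d - 1)`!)%:R :> R)%R.
    by rewrite /X natrX lnXn ?ltr0n ?fact_gt0 // mulr_natl.
  rewrite -lnX in le; clearbody X bad.
  rewrite -(ltr_nat R) natrM !natrX natrB //.
  have X0' : (0 < X%:R :> R)%R by rewrite ltr0n.
  have bad0' : (0 < bad%:R :> R)%R by rewrite ltr0n.
  (* Division by X^t turns the goal into X (1 - bad/X)^t < 1, while [le] says t >= (X/bad) ln X. *)
  rewrite -[ltRHS]mul1r -ltr_pdivrMr ?exprn_gt0 // -mulrA -expr_div_n mulrBl divff ?gt_eqF //.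
  apply: one_sub_pow_lt => //; first by rewrite divr_gt0.
    by rewrite ler_pdivrMr // mul1r ler_nat.
  by rewrite mulrAC ler_pdivlMr // mulrC [(bad%:R * _)%R]mulrC -ler_pdivrMr // mulrAC.
split; first by lia.
  (* With 2d colours every family is avoidable, so any [p] serves. *)
  by apply/packable_bipartiteP => q; exists (q (Ordinal ht)) => b; apply: avoidable_double.
move=> j j0 packj; rewrite leqNgt; apply/negP => lt; apply: npack.
by apply: packableW packj => //; lia.
Qed.
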